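(* Let $C=(c_{ij})$ be an extreme point of $\mathcal{E}_n$. Define the $2n\times 2n$ real symmetric matrix $$P_C=\sum_{i,j=1}^n\frac14\begin{pmatrix}1+c_{ij}&1-c_{ij}\\ 1-c_{ij}&1+c_{ij}\end{pmatrix}\otimes e_ie_j^{\sf T},$$ where $e_1,\ldots,e_n$ is the standard basis of $\mathbb{R}^n$ and $\otimes$ is the Kronecker product. Then $P_C$ is completely positive semidefinite and $\mathrm{cpsd\text{-}rank}(P_C)\ge 2^{\lfloor \mathrm{rank}(C)/2\rfloor}$.
   Context: $\mathcal{E}_n$ is the elliptope: the set of real symmetric positive semidefinite $n\times n$ matrices with all diagonal entries equal to $1$; an extreme point is a point not expressible as a proper convex combination of two distinct points of $\mathcal{E}_n$. A symmetric $N\times N$ matrix $X$ is completely positive semidefinite (cpsd) if there exist $d\ge1$ and $d\times d$ complex Hermitian positive semidefinite matrices $P_1,\ldots,P_N$ with $X_{ij}=\mathrm{Tr}(P_iP_j)$ for all $i,j\in\{1,\ldots,N\}$. The cpsd-rank of a cpsd matrix $X$ is the least such $d$. *)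

(* Defs.v *)
From HB Require Import structures.
From mathcomp Require Import all_boot all_order all_algebra.
From mathcomp Require Import boolp reals.
From mathcomp Require Import complex mxtens.
Set Implicit Arguments. Unset Strict Implicit. Unset Printing Implicit Defensive.
Import Order.TTheory GRing.Theory Num.Theory.
Local Open Scope ring_scope.
Local Open Scope complex_scope.

Definition real_psd (R : realType) (n : nat) (A : 'M[R]_n) : Prop :=
  A^T = A /\ forall v : 'cV[R]_n, 0 <= (v^T *m A *m v) 0 0.

Definition elliptope (R : realType) (n : nat) (A : 'M[R]_n) : Prop :=
  real_psd A /\ forall i : 'I_n, A i i = 1.

Definition extreme_elliptope (R : realType) (n : nat) (C : 'M[R]_n) : Prop :=
  elliptope C /\
  forall (A B : 'M[R]_n) (t : R), elliptope A -> elliptope B ->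
    0 < t < 1 -> C = t *: A + (1 - t) *: B -> A = B.

Definition adjmx (R : realType) (m n : nat) (A : 'M[R[i]]_(m, n)) : 'M[R[i]]_(n, m) :=
  (map_mx Num.conj A)^T.

Definition herm_psd (R : realType) (d : nat) (P : 'M[R[i]]_d) : Prop :=
  adjmx P = P /\ forall v : 'cV[R[i]]_d, 0 <= (adjmx v *m P *m v) 0 0.

Definition cpsd_factorization (R : realType) (N : nat) (d : nat) (X : 'M[R]_N) : Prop :=
  (1 <= d)%N /\
  exists P : 'I_N -> 'M[R[i]]_d,
    (forall k, herm_psd (P k)) /\
    forall k l : 'I_N, (X k l)%:C = \tr (P k *m P l).

Definition cpsd (R : realType) (N : nat) (X : 'M[R]_N) : Prop :=
  X^T = X /\ exists d, cpsd_factorization d X.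

Definition cpsd_rank (R : realType) (N : nat) (X : 'M[R]_N) : nat :=
  match pselect (exists d, `[< cpsd_factorization d X >]) with
  | left h => ex_minn h
  | right _ => 0%N
  end.

Definition PC (R : realType) (n : nat) (C : 'M[R]_n) : 'M[R]_(2 * n) :=
  \sum_(i < n) \sum_(j < n)
    ((\matrix_(a < 2, b < 2)
        (4^-1 * (if a == b then 1 + C i j else 1 - C i j))) *t delta_mx i j).

(* Main.v *)
Require Import Defs.
From HB Require Import structures.
From mathcomp Require Import all_boot all_order all_algebra.
From mathcomp Require Import boolp reals.
From mathcomp Require Import complex mxtens.
From mathcomp Require Import ring lra.
Import Order.TTheory GRing.Theory Num.Theory.
Local Open Scope ring_scope.

(* Writing C as a Gram matrix of unit vectors u_i and taking anticommuting symmetric involutions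
   g_k, the involutions A_i = sum_k u_i(k) g_k have normalized traces c_ij, and the matrices
   (1 +- A_i) / (2 sqrt d) factorize P_C.

   Conversely, let P_(0,i), P_(1,i) be a factorization in dimension d. The Hermitian matrices
   P_(0,i) + P_(1,i) have pairwise inner products 1, so they all equal one matrix D; as
   Tr (P_(0,i) P_(1,i)) = 0, the matrices A_i = P_(0,i) - P_(1,i) satisfy A_i^2 = D^2, and
   Tr (A_i A_j) = c_ij. Every entry of A_i A_j + A_j A_i - 2 c_ij D^2 is, as a function of (i, j),
   a symmetric matrix with zero diagonal whose kernel contains that of C; such a direction can be
   added to and subtracted from C inside the elliptope, so by extremality it is zero. Passing to a
   C-orthonormal basis gives rank C pairwise anticommuting matrices with the common nonzero square
   D^2, and a Clifford module argument on the range of D^2 yields d >= 2 ^ floor(rank C / 2). *)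

(** * Real quadratic forms and orthonormal families *)

Lemma mx11_inj (T : Type) (A B : 'M[T]_1) : A 0 0 = B 0 0 -> A = B.
Proof. by move=> e; apply/matrixP => i j; rewrite !ord1. Qed.

(** Polarization: the form vanishes at [e i] and [e j], so its value at [e i + e j] is
    [2 * A i j]. *)
Lemma quadratic_form_eq0 (R : numFieldType) n (A : 'M[R]_n) :
  A^T = A -> (forall v : 'cV_n, (v^T *m A *m v) 0 0 = 0) -> A = 0.
Proof.
move=> Asym A0; apply/matrixP => i j; rewrite mxE.
pose e k : 'cV[R]_n := delta_mx k 0.
have entry (k l : 'I_n) : ((e k)^T *m A *m e l) 0 0 = A k l.
  rewrite /e trmx_delta -rowE.
  by rewrite -colE !mxE.
have Aji : A j i = A i j by rewrite -{1}Asym mxE.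
have Aii (k : 'I_n) : A k k = 0 by rewrite -entry A0.
have addE (X Y : 'M[R]_1) : (X + Y) 0 0 = X 0 0 + Y 0 0 by rewrite mxE.
have := A0 (e i + e j); rewrite [(_ + _)^T]raddfD /= mulmxDr !mulmxDl.
rewrite !addE !entry !Aii Aji addr0 add0r -mulr2n.
by move/eqP; rewrite mulrn_eq0 /= => /eqP.
Qed.

(* The residual form [C - C M M^T C] is again positive semidefinite, so as long as it is nonzero
   a vector on which it does not vanish extends the C-orthonormal family M. *)
Lemma real_psd_orthonormal_extend (R : realType) n k (C : 'M[R]_n)
    (M : 'M[R]_(n, k)) :
  real_psd C -> M^T *m C *m M = 1%:M -> C <> C *m M *m M^T *m C ->
  exists M' : 'M[R]_(n, k + 1), M'^T *m C *m M' = 1%:M.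
Proof.
move=> [Csym Cpsd] Mon Cn; pose D := C - C *m M *m M^T *m C.
have Dsym : D^T = D by rewrite /D [(_ - _)^T]linearB /= !trmx_mul trmxK Csym !mulmxA.
have [v vn0] : exists v : 'cV[R]_n, (v^T *m D *m v) 0 0 <> 0.
  apply: contrapT => noex; apply: Cn; apply/eqP; rewrite -subr_eq0 -/D.
  apply/eqP/quadratic_form_eq0 => // v.
  by apply: contrapT => h; apply: noex; exists v.
(* [w] is [v] minus its C-orthogonal projection onto the columns of [M]; scaled to length 1, it
   becomes the new column. *)
pose w := v - M *m M^T *m C *m v.
have Mw : M^T *m C *m w = 0 by rewrite /w mulmxBr !mulmxA Mon mul1mx subrr.
have wM : w^T *m C *m M = 0.
  by apply: trmx_inj; rewrite !trmx_mul !trmxK Csym trmx0 mulmxA.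
have wC : w^T *m C *m w = v^T *m D *m v.
  rewrite {2}/w mulmxBr !mulmxA wM !mul0mx subr0.
  by rewrite /w /D [(_ - _)^T]linearB /= !trmx_mul trmxK Csym mulmxBr !mulmxBl !mulmxA.
pose q := (w^T *m C *m w) 0 0.
have q_gt0 : 0 < q by rewrite lt_neqAle Cpsd andbT eq_sym /q wC; apply/eqP.
pose u := (Num.sqrt q)^-1 *: w.
have Mu : M^T *m C *m u = 0 by rewrite /u -scalemxAr Mw scaler0.
have uM : u^T *m C *m M = 0 by rewrite /u [(_ *: _)^T]linearZ /= -!scalemxAl wM scaler0.
have uu : u^T *m C *m u = 1%:M.
  apply: mx11_inj; rewrite /u [(_ *: _)^T]linearZ /= -!scalemxAl -scalemxAr scalerA.
  rewrite mxE -/q [RHS]mxE eqxx -invfM -expr2 sqr_sqrtr ?ltW //.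
  by rewrite mulVf ?gt_eqF.
exists (row_mx M u).
by rewrite tr_row_mx mul_col_mx mul_col_row Mon Mu uM uu -scalar_mx_block.
Qed.

(** A rank count gives an orthonormal family at most [n] members, so it cannot be extended forever;
    it stops growing only when the residual form is zero. *)
Lemma real_psd_orthonormal (R : realType) n (C : 'M[R]_n) : real_psd C ->
  exists k (M : 'M[R]_(n, k)), M^T *m C *m M = 1%:M /\ C = C *m M *m M^T *m C.
Proof.
move=> Cpsd.
have le_n k (M : 'M[R]_(n, k)) : M^T *m C *m M = 1%:M -> (k <= n)%N.
  move=> /(congr1 mxrank); rewrite mxrank1 => <-.
  by apply: leq_trans (mulmx_max_rank _ _) _; apply: leqnn.
apply: contrapT => noM.
suff /(_ n.+1) [M /le_n] : forall k, exists M : 'M[R]_(n, k), M^T *m C *m M = 1%:M.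
  by rewrite ltnn.
elim=> [|k [M Mon]]; first by exists 0; apply/matrixP => -[[]].
rewrite -addn1; apply: (real_psd_orthonormal_extend _ _ _ C M) => // CM.
by apply: noM; exists k, M.
Qed.

(** * Perturbing an extreme point of the elliptope *)

Lemma dot_ge0 (R : realDomainType) n (v : 'cV[R]_n) : 0 <= (v^T *m v) 0 0.
Proof. by rewrite mxE sumr_ge0 // => i _; rewrite !mxE -expr2 sqr_ge0. Qed.

(** Each [|x i * x j|] is at most [x^T x], so the sum of the [|W i j|] is a bound; adding 1 makes it
    positive. *)
Lemma quadratic_form_bound (R : realFieldType) k (W : 'M[R]_k) :
  exists2 K : R, 0 < K &
    forall x : 'cV_k, `|(x^T *m W *m x) 0 0| <= K * (x^T *m x) 0 0.
Proof.
pose K := \sum_i \sum_j `|W i j|.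
have K_ge0 : 0 <= K by rewrite sumr_ge0 // => i _; rewrite sumr_ge0.
exists (1 + K); first by rewrite ltr_pwDl.
move=> x; set N := (x^T *m x) 0 0.
have N_ge0 : 0 <= N by exact: dot_ge0.
have xN i : x i 0 ^+ 2 <= N.
  rewrite /N mxE (bigD1 i) //= mxE expr2 lerDl sumr_ge0 // => j _.
  by rewrite mxE -expr2 sqr_ge0.
have xxN i j : `|x i 0 * x j 0| <= N.
  have h1 := sqr_ge0 (`|x i 0| - `|x j 0|).
  have h2 := xN i; have h3 := xN j.
  rewrite normrM; rewrite -(normr_id (x i 0)) -(normr_id (x j 0)).
  rewrite -[x i 0 ^+ 2]real_normK ?num_real // in h2.
  rewrite -[x j 0 ^+ 2]real_normK ?num_real // in h3.
  move: h1 h2 h3; rewrite !normr_id; move: `|x i 0| `|x j 0| => a b.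
  by nra.
have -> : (x^T *m W *m x) 0 0 = \sum_i \sum_j W i j * (x i 0 * x j 0).
  rewrite mxE exchange_big; apply: eq_bigr => j _; rewrite mxE mulr_suml.
  by apply: eq_bigr => i _; rewrite mxE mulrAC mulrC mulrA.
apply: le_trans (ler_norm_sum _ _ _) _.
rewrite mulrDl mul1r; apply: le_trans (_ : K * N <= _); last by rewrite lerDr.
rewrite /K mulr_suml; apply: ler_sum => i _.
apply: le_trans (ler_norm_sum _ _ _) _; rewrite mulr_suml; apply: ler_sum => j _.
by rewrite normrM ler_wpM2l.
Qed.

(* If C + eps B and C - eps B both lie in the elliptope, extremality forces them to coincide;
   they do for small eps because B factors through C on both sides. *)
Lemma extreme_elliptope_perturbation (R : realType) n (C B : 'M[R]_n) :
  extreme_elliptope C -> B^T = B -> (forall i, B i i = 0) ->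
  (forall v : 'cV_n, C *m v = 0 -> B *m v = 0) -> B = 0.
Proof.
move=> [[Cpsd Cdiag] Cext] Bsym Bdiag BC.
have [Csym _] := Cpsd.
have [k [M [Mon CM]]] := real_psd_orthonormal _ _ _ Cpsd.
(* The columns of [1 - M M^T C] lie in the kernel of [C], hence in that of [B]. *)
have BM : B = B *m M *m M^T *m C.
  apply/matrixP => i j; have := BC (delta_mx j 0 - M *m M^T *m C *m delta_mx j 0).
  rewrite !mulmxBr !mulmxA -CM subrr => /(_ erefl) /eqP; rewrite subr_eq0 -!colE.
  by move=> /eqP /matrixP /(_ i 0); rewrite !mxE.
pose U := C *m M; pose W := M^T *m B *m M.
have CU : C = U *m U^T by rewrite /U trmx_mul Csym mulmxA.
have BU : B = U *m W *m U^T.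
  have BM' : B = C *m M *m M^T *m B.
    by apply: trmx_inj; rewrite !trmx_mul trmxK Csym Bsym !mulmxA.
  by rewrite /U /W trmx_mul Csym !mulmxA -BM' -BM.
have [K K_gt0 WK] := quadratic_form_bound _ _ W.
(* With [x = U^T v] the form of [C + e B] at [v] is [x^T x + e x^T W x], and the bound on [W] keeps
   it nonnegative. *)
have elli (e : R) : `|e| <= K^-1 -> elliptope (C + e *: B).
  move=> he; split=> [|i]; last by rewrite !mxE Bdiag mulr0 addr0.
  split=> [|v]; first by rewrite [(_ + _)^T]linearD /= [(_ *: _)^T]linearZ /= Csym Bsym.
  pose x := U^T *m v.
  have -> : (v^T *m (C + e *: B) *m v) 0 0
      = (x^T *m x) 0 0 + e * (x^T *m W *m x) 0 0.
    rewrite {1}CU {1}BU mulmxDr mulmxDl -scalemxAr -scalemxAl /x.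
    by rewrite [(_ *m v)^T]trmx_mul trmxK !mulmxA [LHS]mxE [X in _ + X]mxE.
  have h : `|e * (x^T *m W *m x) 0 0| <= (x^T *m x) 0 0.
    rewrite normrM; apply: le_trans (ler_pM _ _ he (WK x)) _ => //.
    by rewrite mulrA mulVf ?gt_eqF // mul1r.
  by move: h; rewrite ler_norml => /andP[h _]; rewrite -lerBlDl sub0r.
have e0 : `|K^-1| <= K^-1 by rewrite ger0_norm // invr_ge0 ltW.
have e1 : `|- K^-1| <= K^-1 by rewrite normrN.
have half : 0 < (2^-1 : R) < 1 by apply/andP; split; lra.
have := Cext _ _ _ (elli _ e0) (elli _ e1) half.
have -> : 2^-1 *: (C + K^-1 *: B) + (1 - 2^-1) *: (C + - K^-1 *: B) = C.
  have -> : 1 - 2^-1 = 2^-1 :> R by rewrite {1}(splitr 1) mul1r addrK.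
  rewrite -scalerDr scaleNr addrACA subrr addr0 -mulr2n -scaler_nat scalerA.
  by rewrite mulVf ?scale1r ?pnatr_eq0.
move=> /(_ erefl) /addrI /eqP; rewrite scaleNr -addr_eq0 -scalerDl scaler_eq0.
by rewrite -mulr2n mulrn_eq0 /= invr_eq0 gt_eqF //= => /eqP.
Qed.

(** * Dimension of Clifford modules *)

(* The product p = a b of two generators squares to -S^2 and commutes with all the others, while a
   exchanges the two halves of V on which p acts as i S and -i S; one half carries the remaining
   2(m-1) generators. *)
Lemma clifford_rank (F : fieldType) (i : F) (d m : nat) (S : 'M[F]_d)
    (A : nat -> 'M[F]_d) (V : 'M[F]_d) :
  i * i = -1 -> 2%:R != 0 :> F ->
  (forall k, (k < 2 * m)%N -> A k *m A k = S) ->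
  (forall k l, (k < 2 * m)%N -> (l < 2 * m)%N -> k != l ->
     A k *m A l = - (A l *m A k)) ->
  (forall k, (k < 2 * m)%N -> stablemx V (A k)) ->
  (forall W : 'M[F]_d, (W <= V)%MS -> W *m S = 0 -> W = 0) ->
  V != 0 -> (2 ^ m <= \rank V)%N.
Proof.
move=> ii two_neq0; elim: m V => [|m IHm] V Asq Aanti Vst Vinj Vn0.
  by rewrite expn0 lt0n mxrank_eq0.
have lt2 k : (k < 2 * m)%N -> (k < 2 * m.+1)%N.
  by move=> h; apply: leq_trans h _; rewrite mulnS leq_addl.
have lta : (2 * m < 2 * m.+1)%N by rewrite mulnS -addn1 addnC leq_add2r.
have ltb : ((2 * m).+1 < 2 * m.+1)%N by rewrite mulnS.
pose a := A (2 * m)%N; pose b := A (2 * m).+1; pose p := a *m b.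
have aa : a *m a = S by exact: Asq.
have bb : b *m b = S by exact: Asq.
have ba : b *m a = - (a *m b) by apply: Aanti; rewrite // neq_ltn ltnS leqnn orbT.
have Sp : S *m p = p *m S.
  have -> : S *m p = a *m S *m b by rewrite -aa /p !mulmxA.
  by rewrite -bb /p !mulmxA.
have pa : p *m a = - (a *m p) by rewrite /p -mulmxA ba mulmxN !mulmxA.
have pp : p *m p = - (S *m S).
  by rewrite {2}/p mulmxA pa mulNmx /p !mulmxA aa -!mulmxA bb.
have Sa : S *m a = a *m S by rewrite -aa !mulmxA.
have Akp k : (k < 2 * m)%N -> A k *m p = p *m A k.
  move=> hk; have neqa : k != (2 * m)%N by rewrite neq_ltn hk.
  have neqb : k != (2 * m).+1 by rewrite neq_ltn ltnS ltnW.
  have Aa : A k *m a = - (a *m A k) by exact: Aanti (lt2 _ hk) lta neqa.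
  have Ab : A k *m b = - (b *m A k) by exact: Aanti (lt2 _ hk) ltb neqb.
  by rewrite /p mulmxA Aa mulNmx -(mulmxA a (A k)) Ab mulmxN opprK mulmxA.
have Vp : stablemx V p by apply: stablemxM; apply: Vst.
clearbody p.
have iN0 : i != 0.
  by apply/eqP => i0; move/eqP: ii; rewrite i0 mulr0 eq_sym oppr_eq0 oner_eq0.
have i2N0 : i + i != 0 by rewrite -mulr2n -mulr_natl mulf_neq0.
(* The rows in [V] on which [p] acts as [c S]: an eigenspace of [p] relative to [S]. *)
pose W c := (V :&: kermx (p - c *: S))%MS.
have WP c n (X : 'M_(n, d)) :
    reflect ((X <= V)%MS /\ X *m p = c *: (X *m S)) (X <= W c)%MS.
  rewrite sub_capmx; apply: (iffP andP).
    by move=> [? /sub_kermxP/eqP]; rewrite mulmxBr -scalemxAr subr_eq0 => /eqP.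
  by move=> [? e]; split=> //; apply/sub_kermxP; rewrite mulmxBr -scalemxAr e subrr.
have WV c : (W c <= V)%MS by exact: capmxSl.
have Wst c k : (k < 2 * m)%N -> stablemx (W c) (A k).
  move=> hk; have /WP[_ e] := submx_refl (W c); apply/WP; split.
    by apply: submx_trans (Vst k _); [apply: submxMr | apply: lt2].
  have AkS : A k *m S = S *m A k by rewrite -(Asq _ (lt2 _ hk)) !mulmxA.
  by rewrite -!mulmxA Akp // AkS !mulmxA e -scalemxAl.
(* [a] anticommutes with [p] and commutes with [S], so it maps [W c] into [W (- c)]; it is injective
   on [V] because its square [S] is. *)
have Wa c : (\rank (W c) <= \rank (W (- c)))%N.
  have /WP[_ e] := submx_refl (W c).
  have: (W c *m a <= W (- c))%MS.
    apply/WP; split; first by apply: submx_trans (Vst _ lta); apply: submxMr.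
    have ap : a *m p = - (p *m a) by rewrite pa opprK.
    rewrite -!mulmxA -Sa ap.
    by rewrite mulmxN !mulmxA e -scalemxAl scaleNr.
  move/mxrankS; apply: leq_trans.
  rewrite -(mxrank_mul_ker (W c) a) -[leqRHS]addn0 leq_add2l leqn0 mxrank_eq0.
  apply/eqP/Vinj; first by apply: submx_trans (WV c); apply: capmxSl.
  have /sub_kermxP e0 := capmxSr (W c) (kermx a).
  by rewrite -aa mulmxA e0 mul0mx.
have Wcap : (W i :&: W (- i) = 0)%MS.
  have /WP[_ e1] := capmxSl (W i) (W (- i)).
  have /WP[_ e2] := capmxSr (W i) (W (- i)).
  apply: Vinj; first by apply: submx_trans (WV i); apply: capmxSl.
  apply/eqP; move/eqP: e2; rewrite e1 scaleNr -addr_eq0 -scalerDl scaler_eq0.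
  by rewrite (negPf i2N0).
(* Since [p^2 = - S^2] and [c^2 = -1], one has [(p + c S) p = c (p + c S) S]. *)
have VW c : c * c = -1 -> (V *m (p + c *: S) <= W c)%MS.
  move=> cc; apply/WP; split.
    apply: stablemxD => //.
    rewrite -aa scalemxAl; apply: stablemxM; last exact: Vst.
    by rewrite -scalemxAr; apply: scalemx_sub; exact: Vst.
  rewrite -!mulmxA scalemxAr; congr (_ *m _).
  by rewrite !mulmxDl scalerDr pp -!scalemxAl scalerA cc scaleN1r Sp addrC.
(* If [W i] were zero, so would be [W (- i)]; then [V (p + i S)] and [V (p - i S)] vanish, and so
   does their difference [2 i V S], against injectivity of [S] on [V]. *)
have Wn0 : W i != 0.
  apply: contra Vn0 => /eqP W0; apply/eqP/Vinj; rewrite ?submx_refl //.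
  have W0' : W (- i) = 0.
    apply/eqP; rewrite -mxrank_eq0 -leqn0; have := Wa (- i).
    by rewrite opprK W0 mxrank0.
  have e1 := VW _ ii; have e2 := VW (- i) (etrans (mulrNN _ _) ii).
  move: e1 e2; rewrite W0 W0' !submx0 => /eqP e1 /eqP e2.
  have: V *m (p + i *: S) - V *m (p + - i *: S) = 0 by rewrite e1 e2 subr0.
  rewrite -mulmxBr scaleNr opprD opprK addrACA subrr add0r -scalerDl -scalemxAr.
  by move/eqP; rewrite scaler_eq0 (negPf i2N0) => /eqP.
have IH : (2 ^ m <= \rank (W i))%N.
  apply: IHm Wn0; [by move=> k /lt2 /Asq | | by move=> k /Wst | ].
    by move=> k l /lt2 hk /lt2 hl; exact: Aanti.
  by move=> X hX; apply: Vinj; apply: submx_trans (WV i).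
rewrite expnS mul2n -addnn; apply: leq_trans (leq_add IH (leq_trans IH (Wa i))) _.
rewrite -mxrank_sum_cap Wcap mxrank0 addn0; apply: mxrankS.
by rewrite addsmx_sub !WV.
Qed.

(** * Adjoints and Hermitian positive semidefinite matrices *)

Lemma adjmxD (R : realType) m n (A B : 'M[R[i]%C]_(m, n)) : adjmx (A + B) = adjmx A + adjmx B.
Proof. by apply/matrixP => i j; rewrite !mxE rmorphD. Qed.

Lemma adjmxB (R : realType) m n (A B : 'M[R[i]%C]_(m, n)) : adjmx (A - B) = adjmx A - adjmx B.
Proof. by apply/matrixP => i j; rewrite !mxE rmorphB. Qed.

Lemma adjmxM (R : realType) m n p (A : 'M[R[i]%C]_(m, n)) (B : 'M[R[i]%C]_(n, p)) :
  adjmx (A *m B) = adjmx B *m adjmx A.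
Proof. by rewrite /adjmx map_mxM trmx_mul. Qed.

Lemma adjmxK (R : realType) m n (A : 'M[R[i]%C]_(m, n)) : adjmx (adjmx A) = A.
Proof. by apply/matrixP => i j; rewrite !mxE conjCK. Qed.

Lemma adjmxZ (R : realType) m n (r : R) (A : 'M[R[i]%C]_(m, n)) :
  adjmx (r%:C%C *: A) = r%:C%C *: adjmx A.
Proof.
apply/matrixP => i j; rewrite !mxE rmorphM; congr (_ * _).
by apply: conj_Creal; apply/complex_realP; exists r.
Qed.

Lemma adjmx_sum (R : realType) m n (I : finType) (F : I -> 'M[R[i]%C]_(m, n)) :
  adjmx (\sum_k F k) = \sum_k adjmx (F k).
Proof.
apply/matrixP => i j; rewrite !mxE !summxE rmorph_sum.
by apply: eq_bigr => k _; rewrite !mxE.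
Qed.

Lemma adjmx_real (R : realType) m n (A : 'M[R]_(m, n)) :
  adjmx (map_mx (real_complex R) A) = map_mx (real_complex R) A^T.
Proof.
apply/matrixP => i j; rewrite !mxE.
by apply: conj_Creal; apply/complex_realP; exists (A j i).
Qed.

Lemma adjmxM_ge0 (R : realType) m n (A : 'M[R[i]%C]_(m, n)) i : 0 <= (adjmx A *m A) i i.
Proof. by rewrite mxE sumr_ge0 // => k _; rewrite !mxE mulrC mul_conjC_ge0. Qed.

(** The trace is the sum of the squared moduli of the entries of [A]. *)
Lemma adjmxM_trace_eq0 (R : realType) m n (A : 'M[R[i]%C]_(m, n)) : \tr (adjmx A *m A) = 0 -> A = 0.
Proof.
move=> trA; apply/matrixP => k i; rewrite mxE.
have /eqP := trA; rewrite psumr_eq0 => [|j _]; last exact: adjmxM_ge0.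
move=> /allP /(_ i (mem_index_enum _)) /=; rewrite mxE psumr_eq0 => [|j _]; last first.
  by rewrite !mxE mulrC mul_conjC_ge0.
move=> /allP /(_ k (mem_index_enum _)) /=; rewrite !mxE mulrC mul_conjC_eq0.
by move/eqP.
Qed.

Lemma herm_trace_sqr_eq0 (R : realType) n (A : 'M[R[i]%C]_n) :
  adjmx A = A -> \tr (A *m A) = 0 -> A = 0.
Proof. by move=> Aherm trA; apply: adjmxM_trace_eq0; rewrite Aherm. Qed.

(** Unitary diagonalization, then square roots of the eigenvalues. *)
Lemma herm_psd_gram (R : realType) n (P : 'M[R[i]%C]_n) :
  herm_psd P -> exists U : 'M_n, P = adjmx U *m U.
Proof.
move=> [Pherm Ppsd].
have adjE m p (A : 'M[R[i]%C]_(m, p)) : map_mx Num.conj A^T = adjmx A.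
  by rewrite /adjmx map_trmx.
have Phs : P \is hermitianmx _ false Num.conj.
  by apply/is_hermitianmxP; rewrite expr0 scale1r adjE Pherm.
have /orthomx_spectralP := hermitian_normalmx Phs.
set S := spectralmx P; set D := spectral_diag P => PE.
have Sunit : S *m adjmx S = 1%:M.
  by rewrite -adjE; apply/unitarymxP; exact: spectral_unitarymx.
have SiE : invmx S = adjmx S by rewrite invmx_unitary ?spectral_unitarymx // adjE.
(* The form is tested on the k-th eigenvector, a column of [adjmx S]. *)
have D_ge0 k : 0 <= D 0 k.
  have := Ppsd (adjmx S *m delta_mx k 0).
  rewrite PE SiE adjmxM adjmxK !mulmxA -(mulmxA _ S (adjmx S)) Sunit mulmx1.
  rewrite -(mulmxA _ S (adjmx S)) Sunit mulmx1 -mulmxA -colE.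
  rewrite (_ : adjmx _ = delta_mx 0 k) -?rowE ?mxE ?eqxx ?mulr1n //.
  by apply/matrixP => i j; rewrite !mxE rmorph_nat andbC.
exists (diag_mx (map_mx sqrtC D) *m S).
rewrite adjmxM !mulmxA -(mulmxA (adjmx S)).
have -> : adjmx (diag_mx (map_mx sqrtC D)) *m diag_mx (map_mx sqrtC D) = diag_mx D.
  apply/matrixP => i j; rewrite mul_mx_diag !mxE eq_sym.
  case: eqP => [->|_]; last by rewrite !mulr0n rmorph0 mul0r.
  by rewrite !mulr1n conj_Creal ?ger0_real ?sqrtC_ge0 // -expr2 sqrtCK.
by rewrite -SiE.
Qed.

(** For [P = U^* U] and [Q = V^* V], the trace of [P Q] is the squared Frobenius norm of [U V^*]. *)
Lemma herm_psd_mul_eq0 (R : realType) n (P Q : 'M[R[i]%C]_n) :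
  herm_psd P -> herm_psd Q -> \tr (P *m Q) = 0 -> P *m Q = 0.
Proof.
move=> /herm_psd_gram [U ->] /herm_psd_gram [V ->] trPQ.
have UV : U *m adjmx V = 0.
  apply: adjmxM_trace_eq0; rewrite adjmxM adjmxK -mulmxA mxtrace_mulC -trPQ.
  by rewrite !mulmxA.
by rewrite mulmxA -(mulmxA _ U) UV mulmx0 mul0mx.
Qed.

(** * Clifford generators and a factorization of P_C *)

(** Serves in both directions: to build the A_i from Clifford generators, and to turn given A_i into
    anticommuting matrices by a C-orthonormal change of basis. *)
Lemma anticommutator_linear (F : comNzRingType) n k d (C : 'M[F]_n) (T : 'M[F]_d)
    (A : 'I_n -> 'M[F]_d) (M : 'M[F]_(n, k)) p q :
  (forall i j, A i *m A j + A j *m A i = C i j *: T) ->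
  let G r := \sum_i M i r *: A i in
  G p *m G q + G q *m G p = (M^T *m C *m M) p q *: T.
Proof.
move=> AC G.
have GM r s : G r *m G s = \sum_i \sum_j (M i r * M j s) *: (A i *m A j).
  rewrite mulmx_suml; apply: eq_bigr => i _; rewrite mulmx_sumr.
  by apply: eq_bigr => j _; rewrite -scalemxAl -scalemxAr scalerA.
transitivity (\sum_i \sum_j (M i p * M j q) *: (C i j *: T)); last first.
  rewrite exchange_big mxE scaler_suml; apply: eq_bigr => j _.
  rewrite mxE mulr_suml scaler_suml; apply: eq_bigr => i _.
  by rewrite mxE scalerA mulrAC.
rewrite !GM [X in _ + X]exchange_big -big_split /=.
apply: eq_bigr => i _; rewrite -big_split /=; apply: eq_bigr => j _.
by rewrite -AC scalerDr [M j q * _]mulrC.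
Qed.

(* Jordan-Wigner: the new generator is Z tensor 1, and each old generator g becomes X tensor g. *)
Lemma anticommuting_family (F : comNzRingType) K : exists d (g : nat -> 'M[F]_d),
  (0 < d)%N /\
  forall k, (k < K)%N -> (g k)^T = g k /\ \tr (g k) = 0 /\
    forall l, (l < K)%N ->
      g k *m g l + g l *m g k = (k == l)%:R *: (2 : F)%:M.
Proof.
elim: K => [|K [d [g [d_gt0 gP]]]]; first by exists 1, (fun=> 0).
pose Z : 'M[F]_(d + d) := block_mx 1%:M 0 0 (- 1%:M).
pose g' k := if k == K then Z else block_mx 0 (g k) (g k) 0.
exists (d + d)%N, g'; split; first by rewrite addn_gt0 d_gt0.
have ltK k : (k < K.+1)%N -> (k == K) = false -> (k < K)%N.
  by rewrite ltnS leq_eqVlt => /orP[->|].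
have ZM (A B : 'M[F]_d) : Z *m block_mx 0 A B 0 + block_mx 0 A B 0 *m Z = 0.
  rewrite !mulmx_block add_block_mx !mul0mx !mulmx0 !mul1mx !mulmx1 !mulNmx !mulmxN.
  by rewrite !mul1mx !mulmx1 !add0r !addr0 subrr addNr block_mx0.
move=> k ltk; rewrite /g'; split; [|split].
- case: eqP => [_|/eqP/negPf/(ltK _ ltk)/gP[gk _]].
    by rewrite tr_block_mx !trmx0 linearN /= trmx1.
  by rewrite tr_block_mx !trmx0 gk.
- case: eqP => [_|_]; last by rewrite mxtrace_block !mxtrace0 addr0.
  by rewrite mxtrace_block raddfN /= subrr.
move=> l ltl; case: (k =P K) => [->|/eqP/negPf nk]; case: (l =P K) => [->|/eqP/negPf nl].
- rewrite eqxx scale1r mulmx_block !mul0mx !mulmx0 !mulmxN mulNmx !mul1mx opprK.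
  by rewrite !add0r !addr0 -scalar_mx_block -raddfD.
- by rewrite ZM eq_sym nl scale0r.
- by rewrite addrC ZM nk scale0r.
have [_ [_ gkl]] := gP _ (ltK _ ltk nk).
rewrite !mulmx_block !mul0mx !mulmx0 !add0r !addr0 add_block_mx !addr0.
by rewrite gkl ?ltK // (scalar_mx_block d d) scale_block_mx !scaler0.
Qed.

Lemma PCE (R : realType) n (C : 'M[R]_n) (a b : 'I_2) (i j : 'I_n) :
  PC C (mxtens_index (a, i)) (mxtens_index (b, j))
  = 4^-1 * (1 + (-1) ^+ (a + b) * C i j).
Proof.
rewrite /PC summxE (bigD1 i) //= [X in _ + X]big1 => [|i' ni].
  rewrite addr0 summxE (bigD1 j) //= [X in _ + X]big1 => [|j' nj].
    rewrite addr0 tensmxE !mxE !eqxx mulr1; congr (_ * _).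
    by case: a b => [[|[|//]] ?] [[|[|//]] ?] /=; rewrite ?(expr0, expr1, mul1r, mulN1r) //
      expr2 mulN1r opprK mul1r.
  by rewrite tensmxE !mxE [j == _]eq_sym (negPf nj) andbF mulr0.
rewrite summxE big1 // => j' _.
by rewrite tensmxE !mxE [i == _]eq_sym (negPf ni) mulr0.
Qed.

Lemma herm_psd_scale_gram (R : realType) m n (r : R) (A : 'M[R[i]%C]_(m, n)) :
  0 <= r -> herm_psd (r%:C%C *: (adjmx A *m A)).
Proof.
move=> r_ge0; split=> [|v]; first by rewrite adjmxZ adjmxM adjmxK.
rewrite -scalemxAr -scalemxAl mxE mulr_ge0 ?ler0c //.
rewrite (_ : _ *m v = adjmx (A *m v) *m (A *m v)) ?adjmxM_ge0 //.
by rewrite adjmxM !mulmxA.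
Qed.

Lemma cpsd_factorization_PC (R : realType) n (C : 'M[R]_n) :
  elliptope C -> exists d, cpsd_factorization d (PC C).
Proof.
move=> [Cpsd Cdiag]; have [Csym _] := Cpsd.
have [K [M [_ CM]]] := real_psd_orthonormal _ _ _ Cpsd.
have [d [g [d_gt0 gP]]] := anticommuting_family R K.
pose U := C *m M; have CU : C = U *m U^T by rewrite trmx_mul Csym mulmxA.
(* Column i of [U^T] is the vector u_i of the Gram representation [C = U U^T]. *)
pose A i := \sum_(k < K) U^T k i *: g k.
have AC i j : A i *m A j + A j *m A i = C i j *: 2%:M.
  rewrite (anticommutator_linear _ _ _ _ 1%:M 2%:M (fun k : 'I_K => g k) U^T).
    by rewrite trmxK mulmx1 -CU.
  by move=> k l; have [_ [_ ->]] := gP _ (ltn_ord k); rewrite // mxE.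
have Asym i : (A i)^T = A i.
  rewrite raddf_sum; apply: eq_bigr => k _ /=; rewrite [(_ *: _)^T]linearZ /=.
  by have [->] := gP _ (ltn_ord k).
have trA i : \tr (A i) = 0.
  rewrite raddf_sum big1 // => k _ /=; rewrite mxtraceZ.
  by have [_ [-> _]] := gP _ (ltn_ord k); rewrite mulr0.
have two_neq0 : 2 != 0 :> R by rewrite pnatr_eq0.
have AA i : A i *m A i = 1%:M.
  have := AC i i; rewrite Cdiag scale1r -mulr2n -scaler_nat -scalemx1.
  by move/(scalerI two_neq0).
have trAA i j : \tr (A i *m A j) = d%:R * C i j.
  have := congr1 mxtrace (AC i j).
  rewrite mxtraceD (mxtrace_mulC (A j)) mxtraceZ mxtrace_scalar -mulr2n => h.
  by apply: (mulfI two_neq0); rewrite [LHS]mulr_natl h -[2 *+ d]mulr_natl; ring.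
(* The trace of [E k *m E l] will be d (1 +- c_ij), so scaling both factors by [s] leaves the
   required 1/4 (1 +- c_ij). *)
pose s : R := (2 * Num.sqrt d%:R)^-1.
have s2 : s * s * d%:R = 4^-1.
  have sd : Num.sqrt d%:R != 0 :> R by rewrite gt_eqF // sqrtr_gt0 ltr0n.
  by rewrite /s -{3}[d%:R]sqr_sqrtr ?ler0n //; field.
pose E (k : 'I_(2 * n)) :=
  1%:M + (-1) ^+ (mxtens_unindex k).1 *: A (mxtens_unindex k).2.
have Esym k : (E k)^T = E k.
  by rewrite /E [LHS]linearD /= trmx1 [(_ *: _)^T]linearZ /= Asym.
(* [E k] is twice a projection, hence a positive multiple of its own Gram matrix. *)
have EE k : E k *m E k = 2 *: E k.
  rewrite /E; set x := _ *: A _.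
  have xx : x *m x = 1%:M by rewrite -scalemxAl -scalemxAr scalerA -expr2 sqrr_sign scale1r.
  by rewrite mulmxDl mul1mx mulmxDr mulmx1 xx [x + 1%:M]addrC scaler_nat mulr2n.
exists d; split=> //; exists (fun k => map_mx (real_complex R) (s *: E k)); split.
  move=> k; have -> : s *: E k = (s / 2) *: (E k *m E k).
    by rewrite EE scalerA mulfVK.
  rewrite map_mxZ map_mxM -{1}Esym -adjmx_real; apply: herm_psd_scale_gram.
  by rewrite divr_ge0 ?ler0n // invr_ge0 mulr_ge0 ?ler0n ?sqrtr_ge0.
move=> k l; rewrite -map_mxM trace_map_mx; congr (real_complex R _).
case: (mxtens_indexP k) => a i; case: (mxtens_indexP l) => b j.
rewrite PCE -scalemxAl -scalemxAr !mxtraceZ /E !mxtens_indexK /=.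
rewrite mulmxDl mul1mx mulmxDr mulmx1 -scalemxAr -!scalemxAl !mxtraceD !mxtraceZ.
rewrite !trA trAA mxtrace1 -s2 exprD; ring.
Qed.

(** * Lower bound on the dimension of a factorization *)

(** [B] is symmetric rather than Hermitian, so its real and imaginary parts are both real symmetric
    directions covered by the real case. *)
Lemma extreme_elliptope_perturbation_complex (R : realType) n (C : 'M[R]_n)
    (B : 'M[R[i]%C]_n) :
  extreme_elliptope C -> B^T = B -> (forall i, B i i = 0) ->
  (forall v : 'cV_n, C *m v = 0 -> B *m map_mx (real_complex R) v = 0) -> B = 0.
Proof.
move=> Cext Bsym Bdiag BC.
have ReM (x : R[i]%C) r : complex.Re (x * r%:C%C) = complex.Re x * r.
  by case: x => a b /=; rewrite mulr0 subr0.
have ImM (x : R[i]%C) r : complex.Im (x * r%:C%C) = complex.Im x * r.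
  by case: x => a b /=; rewrite mulr0 add0r.
have part (f : R[i]%C -> R) : {morph f : x y / x + y} -> f 0 = 0 ->
    (forall x r, f (x * r%:C%C) = f x * r) -> map_mx f B = 0.
  move=> fD f0 fM; apply: (extreme_elliptope_perturbation _ _ _ _ Cext).
  - by rewrite map_trmx Bsym.
  - by move=> i; rewrite mxE Bdiag.
  move=> v /BC/matrixP Bv; apply/matrixP => i j; have := congr1 f (Bv i j).
  rewrite !mxE f0 (big_morph f fD f0) => e; rewrite -[RHS]e.
  by apply: eq_bigr => k _; rewrite !mxE fM.
have ReB : map_mx (@complex.Re R) B = 0 by apply: part => // -[? ?] [].
have ImB : map_mx (@complex.Im R) B = 0 by apply: part => // -[? ?] [].
apply/matrixP => i j; apply/eqP; rewrite eq_complex mxE /=.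
by move/matrixP/(_ i j): ReB; move/matrixP/(_ i j): ImB; rewrite !mxE => -> ->; rewrite eqxx.
Qed.

Lemma trace_mulmxBB (F : comNzRingType) n (A B X Y : 'M[F]_n) :
  \tr ((A - B) *m (X - Y)) = \tr (A *m X) - \tr (A *m Y) - (\tr (B *m X) - \tr (B *m Y)).
Proof. by rewrite mulmxBl !mulmxBr !raddfB. Qed.

Lemma PC_factorization_anticommute (R : realType) n d (C : 'M[R]_n) (i0 : 'I_n)
    (P : 'I_(2 * n) -> 'M[R[i]%C]_d) :
  extreme_elliptope C -> (forall k, herm_psd (P k)) ->
  (forall k l, (PC C k l)%:C%C = \tr (P k *m P l)) ->
  exists (S : 'M[R[i]%C]_d) (A : 'I_n -> 'M[R[i]%C]_d),
    [/\ adjmx S = S, S != 0 &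
     forall i j, A i *m A j + A j *m A i = map_mx (real_complex R) C i j *: (2 *: S)].
Proof.
move=> Cext Ppsd PtrE; have [[[Csym _] Cdiag] _] := Cext.
pose Q (a : 'I_2) i := P (mxtens_index (a, i)).
pose z : 'I_2 := 0; pose o : 'I_2 := 1.
have Qpsd a i : herm_psd (Q a i) by exact: Ppsd.
have Qherm a i : adjmx (Q a i) = Q a i by case: (Qpsd a i).
have Qtr a b i j :
    \tr (Q a i *m Q b j) = (4^-1 * (1 + (-1) ^+ (a + b) * C i j))%:C%C.
  by rewrite -PtrE PCE.
have Qzz i j : \tr (Q z i *m Q z j) = (4^-1 * (1 + C i j))%:C%C.
  by rewrite Qtr expr0 mul1r.
have Qzo i j : \tr (Q z i *m Q o j) = (4^-1 * (1 - C i j))%:C%C.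
  by rewrite Qtr expr1 mulN1r.
have Qoz i j : \tr (Q o i *m Q z j) = (4^-1 * (1 - C i j))%:C%C.
  by rewrite Qtr expr1 mulN1r.
have Qoo i j : \tr (Q o i *m Q o j) = (4^-1 * (1 + C i j))%:C%C.
  by rewrite Qtr sqrrN expr1n mul1r.
pose D i := Q z i + Q o i; pose A i := Q z i - Q o i.
have Dherm i : adjmx (D i) = D i by rewrite adjmxD !Qherm.
have Aherm i : adjmx (A i) = A i by rewrite adjmxB !Qherm.
have two_neq0 : 2 != 0 :> R[i]%C by rewrite pnatr_eq0.
have Dtr i j : \tr (D i *m D j) = 1.
  rewrite /D mulmxDl 2!mulmxDr 3!mxtraceD Qzz Qzo Qoz Qoo -!rmorphD /=.
  by rewrite [X in X%:C%C](_ : _ = 1) ?rmorph1 //; field.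
have Atr i j : \tr (A i *m A j) = (C i j)%:C%C.
  rewrite /A trace_mulmxBB Qzz Qzo Qoz Qoo -!rmorphB /=.
  by rewrite [X in X%:C%C](_ : _ = C i j) //; field.
(* The squared norm of [D i - D j] is 1 - 1 - (1 - 1) = 0. *)
have DE i j : D i = D j.
  apply/eqP; rewrite -subr_eq0; apply/eqP/herm_trace_sqr_eq0.
    by rewrite adjmxB !Dherm.
  by rewrite trace_mulmxBB !Dtr !subrr.
pose S := D i0 *m D i0.
have AA i : A i *m A i = S.
  (* The trace of this product is (1 - c_ii) / 4 = 0. Without cross terms, [A i] and [D i] have the
     same square. *)
  have QQ : Q z i *m Q o i = 0.
    apply: herm_psd_mul_eq0 => //; rewrite Qzo Cdiag subrr.
    by rewrite mulr0.
  have QQ' : Q o i *m Q z i = 0.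
    by rewrite -(Qherm o) -(Qherm z) -adjmxM QQ /adjmx map_mx0 trmx0.
  rewrite /S (DE i0 i) /D /A mulmxBl mulmxDl !mulmxBr !mulmxDr QQ QQ'.
  by rewrite !subr0 !sub0r opprK !addr0 add0r.
exists S, A; split.
- by rewrite /S adjmxM !Dherm.
- apply/eqP => S0; have := Dtr i0 i0; rewrite -/S S0 mxtrace0 => /esym/eqP.
  by rewrite oner_eq0.
pose c i j := map_mx (real_complex R) C i j.
pose X i j := A i *m A j + A j *m A i - c i j *: (2 *: S).
have cE i j : c i j = (C i j)%:C%C by rewrite /c mxE.
suff X0 i j : X i j = 0 by move=> i j; apply/eqP; rewrite -subr_eq0; apply/eqP/X0.
apply/matrixP => p q; pose B := \matrix_(i, j) X i j p q.
rewrite [RHS]mxE; suff /matrixP/(_ i j) : B = 0 by rewrite !mxE.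
apply: (extreme_elliptope_perturbation_complex _ _ _ _ Cext).
- apply/matrixP => k l; rewrite mxE [LHS]mxE [RHS]mxE.
  have Ckl : C l k = C k l by rewrite -{1}Csym mxE.
  by rewrite /X !cE Ckl [A l *m _ + _]addrC.
- by move=> k; rewrite mxE /X AA cE Cdiag scale1r scaler_nat mulr2n subrr mxE.
(* The squared norm of [F] is [v^T C v = 0], so [F = 0]. Summing [X k j] against [v] gives
   [A k F + F A k] minus a multiple of [(C v) k], hence zero. *)
move=> v Cv0; pose F := \sum_j (v j 0)%:C%C *: A j.
have Cv k : \sum_j (v j 0)%:C%C * c k j = 0.
  have /matrixP/(_ k 0) := Cv0; rewrite !mxE => e.
  rewrite -[RHS](rmorph0 (real_complex R)) -e rmorph_sum; apply: eq_bigr => m _.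
  by rewrite cE rmorphM mulrC.
have Fherm : adjmx F = F.
  by rewrite adjmx_sum; apply: eq_bigr => m _; rewrite adjmxZ Aherm.
have F0 : F = 0.
  apply: herm_trace_sqr_eq0 => //; rewrite {1}/F mulmx_suml raddf_sum big1 // => k _.
  transitivity ((v k 0)%:C%C * \sum_l (v l 0)%:C%C * c k l); last by rewrite Cv mulr0.
  rewrite /F mulmx_sumr raddf_sum /= mulr_sumr.
  apply: eq_bigr => m _; rewrite -scalemxAl -scalemxAr !mxtraceZ Atr cE //.
have XF k : \sum_j (v j 0)%:C%C *: X k j = 0.
  have -> : \sum_j (v j 0)%:C%C *: X k j
      = A k *m F + F *m A k - (\sum_j (v j 0)%:C%C * c k j) *: (2 *: S).
    rewrite /F mulmx_sumr mulmx_suml scaler_suml -big_split /= -sumrB.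
    apply: eq_bigr => m _.
    by rewrite -scalemxAl -scalemxAr -scalerDr -scalerA -scalerBr.
  by rewrite Cv F0 mulmx0 mul0mx scale0r addr0 subr0.
apply/matrixP => k l; rewrite [RHS]mxE.
have /matrixP/(_ p q) := XF k; rewrite [RHS]mxE summxE mxE => e; rewrite -[RHS]e.
by apply: eq_bigr => m _; rewrite [in LHS]mxE [in RHS]mxE mulrC mxE ord1.
Qed.

Lemma cpsd_factorization_PC_dim (R : realType) n d (C : 'M[R]_n) :
  extreme_elliptope C -> cpsd_factorization d (PC C) ->
  (2 ^ (\rank C %/ 2) <= d)%N.
Proof.
move=> Cext [d_gt0 [P [Ppsd PtrE]]].
(* Exponent 0 is treated apart: [n] may then be 0, leaving no index from which to define [S]. *)
have [r0|r_gt0] := posnP (\rank C %/ 2); first by rewrite r0.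
have n_gt0 : (0 < n)%N.
  by rewrite (leq_trans _ (rank_leq_row C)) // (leq_trans r_gt0) ?leq_div.
have [S [A [Sherm Sn0 AC]]] :=
  PC_factorization_anticommute _ _ _ _ (Ordinal n_gt0) _ Cext Ppsd PtrE.
have [[Cpsd _] _] := Cext.
have [K [M [Mon CM]]] := real_psd_orthonormal _ _ _ Cpsd.
have rK : (\rank C <= K)%N.
  by rewrite CM -mulmxA (leq_trans (mulmx_max_rank _ _)).
pose G (k : 'I_K) := \sum_i map_mx (real_complex R) M i k *: A i.
have GG k l : G k *m G l + G l *m G k = (k == l)%:R *: (2 *: S).
  have := anticommutator_linear _ _ _ _ _ _ _ (map_mx (real_complex R) M) k l AC.
  by rewrite map_trmx -!map_mxM Mon map_mx1 mxE.
have two_neq0 : 2 != 0 :> R[i]%C by rewrite pnatr_eq0.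
have GS k : G k *m G k = S.
  have := GG k k; rewrite eqxx scale1r -mulr2n -scaler_nat.
  exact: (scalerI two_neq0).
(* Extension of [G] by 0 to all naturals; the indices below 2 floor(rank C / 2) all fall below
   [K]. *)
pose g k := oapp G 0 (insub k).
have gE k : (k < 2 * (\rank C %/ 2))%N -> exists2 k' : 'I_K, val k' = k & g k = G k'.
  move=> hk; have ltk : (k < K)%N.
    by apply: leq_trans hk (leq_trans _ rK); rewrite mulnC leq_divM.
  by exists (Ordinal ltk) => //; rewrite /g insubT.
apply: leq_trans (rank_leq_row S).
(* The module is the row space of [S], stable because [S] is the square of each generator. *)
apply: (clifford_rank _ 'i%C _ _ S g S _ two_neq0) => //.
- by rewrite -expr2 sqr_i.
- by move=> k /gE[k' _ ->].
- move=> k l /gE[k' <- ->] /gE[l' <- ->] kl.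
  have nkl : (k' == l') = false by apply: contraNF kl => /eqP ->.
  by apply/eqP; rewrite -addr_eq0 GG nkl scale0r.
- by move=> k /gE[k' _ ->]; rewrite -(GS k') -mulmxA submxMl.
(* [S] is Hermitian, so [Y S S = 0] makes the norm of [Y S] vanish. *)
move=> W /submxP[Y ->] YSS; apply/eqP; rewrite -trmx_eq0; apply/eqP.
have: adjmx (Y *m S) = 0.
  by apply: adjmxM_trace_eq0; rewrite adjmxK adjmxM Sherm mulmxA YSS mul0mx mxtrace0.
by move/(congr1 (@adjmx _ _ _)); rewrite adjmxK => ->; apply/matrixP=> i j; rewrite !mxE rmorph0.
Qed.

Theorem theorem3p1 (R : realType) (n : nat) (C : 'M[R]_n) :
  extreme_elliptope C ->
  cpsd (PC C) /\ (2 ^ (\rank C %/ 2) <= cpsd_rank (PC C))%N.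
Proof.
move=> Cext; have [Cell _] := Cext; have [[Csym _] _] := Cell.
have [d Cd] := cpsd_factorization_PC _ _ _ Cell; split.
  split; last by exists d.
  apply/matrixP => k l; rewrite mxE.
  case: (mxtens_indexP k) => a i; case: (mxtens_indexP l) => b j.
  by rewrite !PCE addnC -{1}Csym mxE.
(* A factorization exists, so the rank is a true minimum and not the default 0. *)
rewrite /cpsd_rank; case: pselect => [ex|[]]; last by exists d; apply/asboolP.
by case: ex_minnP => m /asboolP hm _; apply: cpsd_factorization_PC_dim hm.
Qed.
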